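(* Let $q$ be a power of an odd prime with $q\equiv 1\pmod 4$, let $\chi_4$ be a multiplicative character of order $4$ over $\mathbb{F}_q$, and let $a,b\in\mathbb{F}_q^{\times}$. Set $\lambda=a^2/b$ and assume that $\lambda\notin\{0,-1\}$. Then $$\psi_{(2,4)}(a,b)=q\,\phi(-b)\cdot{}_2F_1\left(\begin{matrix}\chi_4&\chi_4^3\\ {}&\epsilon\end{matrix}\Big|-\lambda\right)+q\,\phi(-a)\cdot{}_2F_1\left(\begin{matrix}\chi_4&\chi_4^3\\ {}&\epsilon\end{matrix}\Big|\frac{-1}{\lambda}\right)-1.$$
   Context: A multiplicative character $\chi$ on $\mathbb{F}_q$ is a homomorphism $\mathbb{F}_q^\times\to\mathbb{C}^\times$, extended by $\chi(0)=0$ (including for the trivial character $\epsilon$). $\phi$ is the quadratic character ($\phi(0)=0$). The character sum is $\psi_{(2,4)}(a,b)=\sum_{x\in\mathbb{F}_q}\phi(x^2+a)\phi(x^4+b)$. $\overline{B}=1/B$ denotes the inverse character. For characters $A,B$ put $J(A,B)=\sum_{x\in\mathbb{F}_q}A(x)B(1-x)$ and $\binom{A}{B}=\frac{B(-1)}{q}J(A,\overline{B})$. For characters $A_0,A_1,B_1$ and $x\in\mathbb{F}_q$, the Gaussian hypergeometric series is $${}_2F_1\left(\begin{matrix}A_0&A_1\\ {}&B_1\end{matrix}\Big|x\right)=\frac{q}{q-1}\sum_{\chi}\binom{A_0\chi}{\chi}\binom{A_1\chi}{B_1\chi}\chi(x),$$ the sum being over all multiplicative characters $\chi$ of $\mathbb{F}_q$.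 *)

(* Defs.v *)
From mathcomp Require Import all_boot all_order all_fingroup all_algebra.
From mathcomp Require Import all_solvable all_field all_character.

Set Implicit Arguments.
Unset Strict Implicit.
Unset Printing Implicit Defensive.

Import GRing.Theory.
Local Open Scope ring_scope.

(* Homomorphisms from the unit group of F to the nonzero complex numbers are  *)
(* its linear characters. Their values are roots of unity, so nothing is lost  *)
(* with algC. The ring operations of class functions are pointwise on units,   *)
(* so products, powers and inverses of characters are the ring ones, and the   *)
(* trivial character is 1.                                                     *)
Notation multChar F := 'CF([set: {unit F}]).

Section HypergeometricSeries.

Variable F : finFieldType.
Implicit Types (A B : multChar F) (x : F).

(* Extension by 0; insub x is None exactly when x = 0. *)
Definition mchar A x : algC :=
  if insub x is Some u then A (u : {unit F}) else 0.

Definition quadChar x : algC :=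
  if x == 0 then 0 else if [exists y : F, y ^+ 2 == x] then 1 else -1.

Definition psi24 (a b : F) : algC :=
  \sum_(x : F) quadChar (x ^+ 2 + a) * quadChar (x ^+ 4 + b).

Definition jacobiSum A B : algC :=
  \sum_(x : F) mchar A x * mchar B (1 - x).

Definition charBinom A B : algC :=
  mchar B (-1) / #|F|%:R * jacobiSum A B^-1.

(* Every linear character is irreducible, so irr lists each of them once. *)
Definition hyp2F1 A0 A1 B1 x : algC :=
  #|F|%:R / (#|F|%:R - 1) *
  \sum_(chi <- irr [set: {unit F}] | chi \is a linear_char)
    charBinom (A0 * chi) chi * charBinom (A1 * chi) (B1 * chi) * mchar chi x.

(* quadChar is the character of order 2, extended by 0. *)
Lemma mchar_order2 (phi : multChar F) :
  phi \is a linear_char -> #[phi]%CF = 2%N -> mchar phi =1 quadChar.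
Proof.
move=> Lphi o2 x; rewrite /mchar /quadChar.
case: insubP => [u Ux <-|]; last by rewrite unitfE negbK => ->.
rewrite (negPf (_ : val u != 0)) -?unitfE ?(valP u) //.
have phi2 v : phi v ^+ 2 = 1.
  have /(congr1 (fun f : multChar F => f v)) := exp_cforder phi.
  by rewrite o2 -lin_charX ?inE // exp_cfunE ?inE // cfun1E inE lin_charX ?inE.
case: existsP => [[y /eqP y2]|nsq].
  have Uy : y \is a GRing.unit by rewrite -(unitrX_pos y (n := 2)) // y2 (valP u).
  have -> : u = ((FinRing.unit F Uy) ^+ 2)%g by apply: val_inj; rewrite FinRing.val_unitX.
  by rewrite lin_charX ?inE.
have /cyclicP[g Dg] := field_unit_group_cyclic [set: {unit F}]%G.
have gen v : exists k, v = (g ^+ k)%g.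
  by apply/cycleP; rewrite -Dg inE.
have phig : phi g = -1.
  have /eqP := phi2 g; rewrite sqrf_eq1 => /orP[]/eqP // g1.
  suff phi1 : phi = 1 by have := dvdn_cforder phi 1; rewrite o2 expr1 phi1 eqxx.
  apply/cfunP=> v; have [k ->] := gen v.
  by rewrite lin_charX ?inE // g1 expr1n cfun1E inE.
have [k Dk] := gen u; rewrite Dk lin_charX ?inE // phig.
rewrite -signr_odd; case: (boolP (odd k)) => // ek; case: nsq.
exists (val (g ^+ k./2)%g); rewrite -FinRing.val_unitX -expgM muln2 Dk.
by rewrite -{2}(odd_double_half k) (negPf ek).
Qed.

End HypergeometricSeries.

(* Main.v *)
Require Import Defs.
From mathcomp Require Import all_boot all_order all_fingroup all_algebra.
From mathcomp Require Import all_solvable all_field all_character.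
From mathcomp Require Import ring.

(** Write [phi] for the quadratic character, [q = #|F|], and
    [G x = q * hyp2F1 chi4 (chi4 ^+ 3) 1 x]. Everything is reduced to the
    cubic sums [S a b = \sum_y phi (y + a) * phi (y ^+ 2 + b)].

    The character sum: since [1 + phi y] counts the square roots of [y],
    substituting [y = x ^+ 2] in [psi24] gives [S a b] plus the same sum weighted
    by [phi y]; the inversion [y -> 1 / y] turns the latter into
    [phi (a * b) * S (1 / a) (1 / b)], up to the missing term at infinity, which
    is the [- 1] ([psi24_cubic_sums]). As [lambda] becomes [1 / lambda] under
    [(a, b) -> (1 / a, 1 / b)], it remains to show
    [S a b = phi (- a) * G (- b / a ^+ 2)].

    The hypergeometric side: expanding the Jacobi sums and summing over [chi] by
    orthogonality leaves a sum over the curve [x y z = (1 - y) (1 - z)]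
    ([hyp2F1_count]). In the coordinates [y = t / w], [z = 1 / w] this curve is
    quadratic in [w], so [G x] is the sum over [t] of [chi4 t] times [phi] of the
    discriminant [(1 - t) ^+ 2 + 4 x t] ([hyp2F1_inv]). The map [t -> 1 / t]
    preserves [phi] of the discriminant and sends [chi4] to [phi * chi4], so only
    the average over [t] and [1 / t] matters; this restricts the sum to squares
    [t = s ^+ 2], where [chi4 t = phi s], and [w = s + 1 / s] yields
    [G x = \sum_w phi (w + 2) * phi (w ^+ 2 + 4 x - 4)] ([hyp2F1_chi4]).

    The two sides meet through a 2-isogeny: the curves
    [v ^+ 2 = (y + a) (y ^+ 2 + b)] and
    [v ^+ 2 = (w + 2) (w ^+ 2 - 4 (b / a ^+ 2) - 4)], the latter twisted by [- a],
    are 2-isogenous, hence have equal character sums. On the level of sums the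
    isogeny is again a substitution [w = X + c / X] ([two_isogeny_sum]). So the
    single identity [sum_add_inv], which evaluates sums of a function of
    [x + b / x], drives both halves. *)

Set Implicit Arguments.
Unset Strict Implicit.
Unset Printing Implicit Defensive.

Import GRing.Theory Num.Theory.
Local Open Scope ring_scope.

(** * Characters of the unit group extended by 0 *)

Section MultiplicativeCharacters.

Variable F : finFieldType.
Implicit Types (A B : multChar F) (x y z : F).

Lemma mchar0 A : mchar A 0 = 0.
Proof. by rewrite /mchar insubF ?unitr0. Qed.

Lemma mchar_val A (u : {unit F}) : mchar A (val u) = A u.
Proof. by rewrite /mchar valK. Qed.

Lemma neq0_val x : x != 0 -> exists u : {unit F}, x = val u.
Proof. by rewrite -unitfE => Ux; exists (FinRing.unit F Ux). Qed.

Lemma mcharMl A B x : mchar (A * B) x = mchar A x * mchar B x.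
Proof.
have [->|/neq0_val[u ->]] := eqVneq x 0; first by rewrite !mchar0 mulr0.
by rewrite !mchar_val cfunE.
Qed.

Lemma mcharM A : A \is a linear_char -> {morph mchar A : x y / x * y}.
Proof.
move=> LA x y.
have [->|/neq0_val[u ->]] := eqVneq x 0; first by rewrite mul0r !mchar0 mul0r.
have [->|/neq0_val[v ->]] := eqVneq y 0; first by rewrite mulr0 !mchar0 mulr0.
by rewrite -FinRing.val_unitM !mchar_val lin_charM ?inE.
Qed.

Lemma mchar1 A : A \is a linear_char -> mchar A 1 = 1.
Proof. by move=> LA; rewrite -FinRing.val_unit1 mchar_val lin_char1. Qed.

Lemma mchar_neq0 A x : A \is a linear_char -> x != 0 -> mchar A x != 0.
Proof. by move=> LA /neq0_val[u ->]; rewrite mchar_val lin_char_neq0 ?inE. Qed.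

Lemma mcharX A x n : A \is a linear_char -> mchar A (x ^+ n) = mchar A x ^+ n.
Proof.
move=> LA; elim: n => [|n IHn]; first by rewrite !expr0 mchar1.
by rewrite !exprS mcharM ?IHn.
Qed.

Lemma mcharV A x : A \is a linear_char -> mchar A x^-1 = (mchar A x)^-1.
Proof.
move=> LA; have [->|x0] := eqVneq x 0; first by rewrite invr0 mchar0 invr0.
apply: (mulIf (mchar_neq0 LA x0)).
by rewrite -mcharM // !mulVf ?mchar_neq0 // mchar1.
Qed.

Lemma mcharVl A x : A \is a linear_char -> mchar A^-1 x = mchar A x^-1.
Proof.
move=> LA; have [->|/neq0_val[u ->]] := eqVneq x 0.
  by rewrite invr0 !mchar0.
rewrite mcharV // !mchar_val invr_lin_char // cfunE.
by rewrite -(lin_charV LA) ?inE //; apply/esym/lin_charV_conj; rewrite ?inE.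
Qed.

(** Multiplying the variable by a point where [A] differs from 1 multiplies the
    sum by that value and only permutes its terms. *)
Lemma sum_mchar_eq0 A : A \is a linear_char -> A != 1 ->
  \sum_(x : F) mchar A x = 0.
Proof.
move=> LA A1; have [u Au1] : exists u, A u != 1.
  apply/existsP; apply: contraR A1; rewrite negb_exists => /forallP A1.
  apply/eqP/cfunP=> u; rewrite cfun1E inE.
  by have := A1 u; rewrite negbK => /eqP.
have u0 : val u != 0 by rewrite -unitfE (valP u).
set S := \sum_x _; have : A u * S = S.
  rewrite /S mulr_sumr [RHS](reindex_inj (mulfI u0)).
  by apply: eq_bigr => x _; rewrite mcharM // mchar_val.
by move/eqP; rewrite -subr_eq0 -{2}[S]mul1r -mulrBl mulf_eq0 subr_eq0 (negPf Au1) /= => /eqP.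
Qed.

(** Column orthogonality for the character table of the abelian group of units,
    read at the columns of [z] and 1. *)
Lemma sum_lin_mchar z :
  \sum_(chi <- irr [set: {unit F}] | chi \is a linear_char) mchar chi z
    = (#|F|%:R - 1) * (z == 1)%:R.
Proof.
have cUU : abelian [set: {unit F}].
  exact/cyclic_abelian/field_unit_group_cyclic.
rewrite big_tuple (eq_bigl predT) => [|i]; last exact/char_abelianP.
have [->|/neq0_val[u ->]] := eqVneq z 0.
  by rewrite (eq_sym 0) oner_eq0 mulr0 big1 // => i _; rewrite mchar0.
have := second_orthogonality_relation u (in_setT (1%g : {unit F})).
have -> : 'C_[set: {unit F}][u]%g = [set: {unit F}].
  by apply/setIidPl; rewrite sub_cent1 (subsetP cUU) ?inE.
rewrite class1G inE card_finField_unit -mulr_natr.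
have -> : (u == 1%g) = (val u == 1) by [].
rewrite -(@prednK #|F|) ?(ltnW (finNzRing_gt1 F)) // -natr1 addrK => <-.
apply: eq_bigr => i _; rewrite mchar_val lin_char1 ?rmorph1 ?mulr1 //.
exact/char_abelianP.
Qed.

End MultiplicativeCharacters.

(** * Quadratic character sums *)

Section QuadraticCharacterSums.

Variables (F : finFieldType) (phi : multChar F).
Hypotheses (Lphi : phi \is a linear_char) (o2 : #[phi]%CF = 2%N).
Implicit Types (f g : F -> algC) (a b c w x y z : F).

(** Half of the even number [#|F| - 1] witnesses that 2 divides -1 in [F]. *)
Lemma two_neq0 : 2%:R != 0 :> F.
Proof.
have := cforder_lin_char_dvdG Lphi; rewrite o2 card_finField_unit.
case/dvdnP=> k Dk; apply/eqP=> F2.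
have : (#|F|%:R == 0 :> F).
  by rewrite -FinRing.zmodXgE -cardsT expg_cardG ?inE.
rewrite -(@prednK #|F|) ?(ltnW (finNzRing_gt1 F)) // -natr1 Dk natrM F2.
by rewrite mulr0 add0r oner_eq0.
Qed.

Lemma quadChar0 : quadChar (0 : F) = 0.
Proof. by rewrite /quadChar eqxx. Qed.

Lemma quadChar_sqr x : x != 0 -> quadChar (x ^+ 2) = 1.
Proof.
move=> x0; rewrite /quadChar expf_eq0 (negPf x0) /=.
by case: existsP => // -[]; exists x.
Qed.

Lemma quadCharM : {morph (@quadChar F) : x y / x * y}.
Proof. by move=> x y; rewrite -!(mchar_order2 Lphi o2) mcharM. Qed.

Lemma quadChar_sqrM x y : x != 0 -> quadChar (x ^+ 2 * y) = quadChar y.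
Proof. by move=> x0; rewrite quadCharM quadChar_sqr ?mul1r. Qed.

Lemma sum_quadChar : \sum_(x : F) quadChar x = 0.
Proof.
rewrite -[RHS](sum_mchar_eq0 Lphi); last first.
  by apply/negP=> p1; have := dvdn_cforder phi 1; rewrite o2 expr1 p1.
by apply: eq_bigr => x _; rewrite (mchar_order2 Lphi o2).
Qed.

Lemma count_sqrt c : \sum_(x : F | x ^+ 2 == c) 1 = 1 + quadChar c.
Proof.
rewrite /quadChar; have [->|c0] := eqVneq c 0.
  by rewrite addr0 (big_pred1 0) // => x /=; rewrite expf_eq0.
case: existsP => [[y /eqP Dc]|nsq]; last first.
  by rewrite subrr big_pred0 // => x; apply/negP=> xc; case: nsq; exists x.
have y0 : y != 0 by apply: contraNneq c0 => y0; rewrite -Dc y0 expr0n.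
rewrite (bigD1 y) ?Dc //= (bigD1 (- y)) /=; last first.
  rewrite sqrrN Dc eqxx /= eq_sym -subr_eq0 opprK -mulr2n -mulr_natl.
  by rewrite mulf_neq0 ?two_neq0.
rewrite big_pred0 ?addr0 // => x; rewrite -Dc eqf_sqr.
by case: (x == y); case: (x == - y); rewrite ?andbF.
Qed.

Lemma sum_fibre (P : pred F) (h : F -> F) f :
  \sum_(x | P x) f (h x) = \sum_w (\sum_(x | P x && (h x == w)) 1) * f w.
Proof.
rewrite (partition_big h predT) //=; apply: eq_bigr => w _.
by rewrite mulr_suml; apply: eq_bigr => x /andP[_ /eqP->]; rewrite mul1r.
Qed.

Lemma sum_sqr f : \sum_x f (x ^+ 2) = \sum_c (1 + quadChar c) * f c.
Proof. by rewrite sum_fibre; apply: eq_bigr => c _; rewrite count_sqrt. Qed.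

(** Completing the square. *)
Lemma count_quadratic_roots w b :
  \sum_(x : F | x ^+ 2 - w * x + b == 0) 1 = 1 + quadChar (w ^+ 2 - 4%:R * b).
Proof.
have n2 := two_neq0; rewrite -count_sqrt.
rewrite [RHS](reindex (fun x => 2%:R * x - w)) /=; last first.
  exists (fun y => (y + w) / 2%:R) => x _; first by rewrite subrK mulrAC divff ?mul1r.
  by rewrite mulrC divfK // addrK.
apply: eq_bigl => x; rewrite -[RHS]subr_eq0.
have -> : (2%:R * x - w) ^+ 2 - (w ^+ 2 - 4%:R * b) = 2%:R ^+ 2 * (x ^+ 2 - w * x + b).
  by ring.
by rewrite mulf_eq0 expf_eq0 (negPf n2).
Qed.

(** For nonzero [x], the equation [x + b / x = w] is quadratic in [x] with
    discriminant [w ^+ 2 - 4 * b]. *)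
Lemma sum_add_inv b f : b != 0 ->
  \sum_(x | x != 0) f (x + b / x) =
  \sum_w (1 + quadChar (w ^+ 2 - 4%:R * b)) * f w.
Proof.
move=> b0; rewrite sum_fibre; apply: eq_bigr => w _.
rewrite -count_quadratic_roots; congr (_ * _); apply: eq_bigl => x.
have [->|x0] /= := eqVneq x 0; first by rewrite expr0n mulr0 subrr add0r (negPf b0).
rewrite -subr_eq0 -(mulrI_eq0 _ (mulfI x0)); congr (_ == 0).
by field.
Qed.

Lemma sum_add1_mul f g :
  \sum_x (1 + g x) * f x = \sum_x f x + \sum_x g x * f x.
Proof.
by rewrite -big_split /=; apply: eq_bigr => x _; rewrite mulrDl mul1r.
Qed.

Lemma sum_quadChar_shift c : \sum_(x : F) quadChar (x + c) = 0.
Proof. by rewrite -[RHS]sum_quadChar [RHS](reindex_inj (addIr c)). Qed.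

(** With [X = y + a] and [c = a ^+ 2 + b] the left-hand summand is [phi] of
    [X (X ^+ 2 - 2 a X + c) = X ^+ 2 (X + c / X - 2 a)], so it only depends on
    [w = X + c / X]. The fibres of this map have [1 + phi (w ^+ 2 - 4 c)] points:
    the first term contributes the vanishing sum of [phi (w - 2 a)], and the
    second one the sum over the isogenous curve, normalised by [w -> - a w]. *)
Lemma two_isogeny_sum a b : a != 0 -> a ^+ 2 + b != 0 ->
  \sum_y quadChar (y + a) * quadChar (y ^+ 2 + b) =
  quadChar (- a) *
    \sum_w quadChar (w + 2%:R) *
      quadChar (w ^+ 2 + 4%:R * (- (b / a ^+ 2)) - 4%:R).
Proof.
move=> a0 c0; rewrite (reindex_inj (addIr (- a))) /=.
transitivity
    (\sum_(x : F | x != 0) quadChar (x + (a ^+ 2 + b) / x - 2%:R * a)).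
  rewrite (bigD1 0) //= subrK quadChar0 mul0r add0r; apply: eq_bigr => x x0.
  rewrite subrK -quadCharM -[RHS](quadChar_sqrM _ x0); congr quadChar.
  by field.
rewrite (sum_add_inv (fun w => quadChar (w - 2%:R * a))) //.
rewrite sum_add1_mul sum_quadChar_shift add0r.
have na0 : - a != 0 by rewrite oppr_eq0.
rewrite (reindex_inj (mulfI na0)) mulr_sumr; apply: eq_bigr => w _ /=.
rewrite mulrC mulrA -quadCharM; congr (quadChar _ * _); first by ring.
rewrite -[RHS](quadChar_sqrM _ na0); congr quadChar.
by field.
Qed.

(** The terms with weight [phi y] are inverted; the point 0 that replaces
    infinity in the resulting sum would contribute
    [phi (a b) * phi (1 / a) * phi (1 / b) = 1], whence the [- 1]. *)
Lemma psi24_cubic_sums a b : a != 0 -> b != 0 ->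
  psi24 a b =
    \sum_y quadChar (y + a) * quadChar (y ^+ 2 + b) +
    quadChar (a * b) *
      (\sum_y quadChar (y + a^-1) * quadChar (y ^+ 2 + b^-1)) - 1.
Proof.
move=> a0 b0; rewrite /psi24.
under eq_bigr do rewrite -[4%N]/(2 * 2)%N exprM.
rewrite (sum_sqr (fun y => quadChar (y + a) * quadChar (y ^+ 2 + b))).
rewrite sum_add1_mul -addrA; congr (_ + _).
rewrite (reindex_inj invr_inj) /= (bigD1 0) //= invr0 quadChar0 mul0r add0r.
rewrite [X in _ * X](bigD1 0) //= mulrDr !add0r expr0n add0r.
rewrite -!quadCharM mulrACA !mulfV // mulr1.
rewrite -(expr1n F 2) quadChar_sqr ?oner_neq0 // addrAC subrr add0r mulr_sumr.
apply: eq_bigr => y y0.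
rewrite -!quadCharM -[LHS](quadChar_sqrM _ y0) -[LHS](quadChar_sqrM _ y0).
by congr quadChar; field; rewrite ?a0 ?b0 ?y0.
Qed.

Hypothesis phiN1 : quadChar (-1 : F) = 1.

Lemma quadCharN x : quadChar (- x) = quadChar x.
Proof. by rewrite -mulN1r quadCharM phiN1 mul1r. Qed.

(** Away from [x = -1], [phi x = phi (x + 1 / x + 2)] because
    [x + 1 / x + 2 = (x + 1) ^+ 2 / x]; so the left-hand side is a sum over
    [w = x + 1 / x], with fibre count [1 + phi (w ^+ 2 - 4)], and
    [(w ^+ 2 - 4) (w + 2) = (w + 2) ^+ 2 (w - 2)] gives the second term on the
    right. *)
Lemma sum_quadChar_add_inv f :
  \sum_(x | x != 0) quadChar x * f (x + x^-1) =
  \sum_w (quadChar (w + 2%:R) + quadChar (w - 2%:R)) * f w.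
Proof.
have n2 := two_neq0.
have := sum_add_inv (fun w => quadChar (w + 2%:R) * f w) (oner_neq0 F).
(* The exceptional points x = -1 and w = -2 correspond and are compared apart. *)
rewrite (bigD1 (-1)) ?oppr_eq0 ?oner_neq0 //=.
rewrite [X in _ = X](bigD1 (- 2%:R)) //=.
rewrite [LHS in _ -> LHS = _](bigD1 (-1)) ?oppr_eq0 ?oner_neq0 //=.
rewrite [RHS in _ -> _ = RHS](bigD1 (- 2%:R)) //=.
rewrite mul1r invrN1 -opprD.
rewrite addNr quadChar0 !mul0r mulr0 !add0r phiN1.
have -> : - 2%:R - 2%:R = - 2%:R ^+ 2 :> F by ring.
rewrite quadCharN quadChar_sqr // => E; congr (_ + _).
transitivity (\sum_(x : F | (x != 0) && (x != -1))
    quadChar (x + 1 / x + 2%:R) * f (x + 1 / x)).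
  apply: eq_bigr => x /andP[x0 x1]; rewrite div1r; congr (_ * _).
  have x1' : (x + 1) / x != 0 by rewrite mulf_neq0 ?invr_eq0 // addr_eq0.
  rewrite -(quadChar_sqrM _ x1'); congr quadChar.
  by field.
rewrite {}E; apply: eq_bigr => w w2; rewrite mulrA; congr (_ * _).
rewrite mulrDl mul1r -quadCharM; congr (_ + _).
have w2' : w + 2%:R != 0 by rewrite addr_eq0.
rewrite -[RHS](quadChar_sqrM _ w2'); congr quadChar.
by ring.
Qed.

End QuadraticCharacterSums.

(** * Hypergeometric series as point counts *)

Section HypergeometricValues.

Variable F : finFieldType.
Implicit Types (A B chi : multChar F) (t w x y z : F).

Lemma charBinom_sum A chi : chi \is a linear_char ->
  charBinom (A * chi) chi =
  mchar chi (-1) / #|F|%:R *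
    \sum_y mchar A y * mchar chi (y / (1 - y)).
Proof.
move=> Lchi; congr (_ * _); apply: eq_bigr => y _.
by rewrite mcharMl mcharVl // -mulrA -mcharM.
Qed.

(** Each summand of the two Jacobi sums contains [chi] of a single point, so the
    sum over [chi] becomes an indicator by orthogonality. The two signs
    [chi (-1)] cancel. *)
Lemma hyp2F1_count A B x : A \is a linear_char -> B \is a linear_char ->
  #|F|%:R * hyp2F1 A B 1 x =
  \sum_y \sum_z mchar A y * mchar B z *
    (y / (1 - y) * (z / (1 - z)) * x == 1)%:R.
Proof.
move=> LA LB; rewrite /hyp2F1.
pose term chi y z := mchar A y * mchar B z *
  mchar chi (y / (1 - y) * (z / (1 - z)) * x).
have q0 : #|F|%:R != 0 :> algC.
  by rewrite pnatr_eq0 -lt0n (ltnW (finNzRing_gt1 F)).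
have q1 : #|F|%:R - 1 != 0 :> algC.
  by rewrite subr_eq0 pnatr_eq1 neq_ltn (finNzRing_gt1 F) orbT.
transitivity ((#|F|%:R - 1)^-1 *
  \sum_(chi <- irr [set: {unit F}] | chi \is a linear_char)
    \sum_y \sum_z term chi y z).
  rewrite mulrA mulr_sumr [RHS]mulr_sumr; apply: eq_bigr => chi Lchi.
  rewrite mul1r !charBinom_sum //.
  have -> : \sum_y \sum_z term chi y z =
      (\sum_y mchar A y * mchar chi (y / (1 - y))) *
      (\sum_z mchar B z * mchar chi (z / (1 - z))) * mchar chi x.
    rewrite mulr_suml mulr_suml; apply: eq_bigr => y _.
    rewrite mulr_sumr mulr_suml; apply: eq_bigr => z _.
    by rewrite /term !mcharM //; ring.
  have N1 : mchar chi (-1) ^+ 2 = 1 by rewrite -mcharX // sqrrN expr1n mchar1.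
  set S := \sum_y _; set T := \sum_z _.
  transitivity (mchar chi (-1) ^+ 2 * ((#|F|%:R - 1)^-1 * (S * T * mchar chi x))).
    by field; rewrite q1.
  by rewrite N1 mul1r.
rewrite exchange_big mulr_sumr; apply: eq_bigr => y _.
rewrite exchange_big mulr_sumr; apply: eq_bigr => z _.
by rewrite -mulr_sumr sum_lin_mchar mulrCA mulKf.
Qed.

Variable phi : multChar F.
Hypotheses (Lphi : phi \is a linear_char) (o2 : #[phi]%CF = 2%N).

(** For opposite characters only the ratio [t = y / z] matters. With [z = 1 / w]
    the incidence condition becomes [w ^+ 2 - (1 + t) w + t (1 - x) = 0], whose
    number of roots is [1 + phi] of its discriminant; the [1] disappears because
    [A] sums to 0. *)
Lemma hyp2F1_inv A x : A \is a linear_char -> A != 1 -> x != 0 -> x != 1 ->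
  #|F|%:R * hyp2F1 A A^-1 1 x =
  \sum_t mchar A t * quadChar ((1 - t) ^+ 2 + 4%:R * x * t).
Proof.
move=> LA A1 x0 x1; rewrite hyp2F1_count ?rpredVr //.
transitivity (\sum_t mchar A t *
    (1 + quadChar ((1 + t) ^+ 2 - 4%:R * (t * (1 - x))))); last first.
  under eq_bigr => t _ do rewrite mulrDr mulr1.
  rewrite big_split /= sum_mchar_eq0 // add0r; apply: eq_bigr => t _.
  by congr (_ * quadChar _); ring.
rewrite exchange_big (reindex_inj invr_inj) /=.
transitivity (\sum_w \sum_t mchar A t *
    (w ^+ 2 - (1 + t) * w + t * (1 - x) == 0)%:R); last first.
  rewrite exchange_big; apply: eq_bigr => t _.
  rewrite -(count_quadratic_roots Lphi o2) -mulr_sumr [in RHS]big_mkcond.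
  by congr (_ * _); apply: eq_bigr => w _; case: ifP.
apply: eq_bigr => w _; have [->|w0] := eqVneq w 0.
  rewrite !big1 // => t _; last by rewrite invr0 mchar0 mulr0 mul0r.
  have [->|t0] := eqVneq t 0; first by rewrite mchar0 mul0r.
  rewrite expr0n mulr0 subrr add0r mulf_eq0 (negPf t0) subr_eq0 eq_sym.
  by rewrite (negPf x1) mulr0.
have w0' : w^-1 != 0 by rewrite invr_eq0.
rewrite (reindex_inj (mulIf w0')) /=; apply: eq_bigr => t _.
have [->|t0] := eqVneq t 0; first by rewrite mul0r mchar0 !mul0r.
rewrite mcharVl // -mcharM // invrK divfK //; congr (_ * _%:R); congr nat_of_bool.
have tx0 : - (t * x) != 0 by rewrite oppr_eq0 mulf_neq0.
(* At w = 1 and w = t a fraction has denominator 0, hence value 0, while the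
   quadratic takes the nonzero value - t x; both conditions fail. *)
have [->|w1] := eqVneq w 1.
  rewrite invr1 subrr invr0 !(mulr0, mul0r) eq_sym oner_eq0.
  by apply/esym/negbTE; apply: contraNneq tx0 => <-; apply/eqP; ring.
have [->|wt] := eqVneq w t.
  rewrite divff // subrr invr0 !(mulr0, mul0r) eq_sym oner_eq0.
  by apply/esym/negbTE; apply: contraNneq tx0 => <-; apply/eqP; ring.
have d0 : (w - t) * (w - 1) != 0 by rewrite mulf_neq0 ?subr_eq0.
rewrite -subr_eq0 -(mulrI_eq0 _ (mulfI d0)) -oppr_eq0; congr (_ == 0).
by field; rewrite w0 !subr_eq0 wt w1.
Qed.

End HypergeometricValues.

(** * The series attached to a quartic character *)

Section QuarticCharacter.

Variables (F : finFieldType) (chi4 : multChar F).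
Hypotheses (Lchi4 : chi4 \is a linear_char) (o4 : #[chi4]%CF = 4%N).

Lemma lin_char_sqr4 : chi4 ^+ 2 \is a linear_char.
Proof. exact: rpredX. Qed.

Lemma cforder_sqr4 : #[chi4 ^+ 2]%CF = 2%N.
Proof.
apply/eqP; rewrite eqn_dvd dvdn_cforder -exprM -dvdn_cforder o4 /=.
have := dvdn_cforder chi4 (2 * #[chi4 ^+ 2]%CF).
by rewrite exprM exp_cforder eqxx o4 (@dvdn_pmul2l 2 2).
Qed.

Local Notation Lphi := lin_char_sqr4.
Local Notation o2 := cforder_sqr4.

Lemma mchar_sqr4 (x : F) : mchar chi4 (x ^+ 2) = quadChar x.
Proof.
by rewrite -(mchar_order2 Lphi o2) mcharX // [chi4 ^+ 2]expr2 mcharMl.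
Qed.

Lemma quadCharN1 : quadChar (-1 : F) = 1.
Proof. by rewrite -mchar_sqr4 sqrrN expr1n mchar1. Qed.

Lemma invr_chi4 : chi4^-1 = chi4 ^+ 3.
Proof.
have U := lin_char_unitr Lchi4; apply: (mulIr U).
by rewrite mulVr // -exprSr -o4 exp_cforder.
Qed.

Lemma mchar4V (x : F) : mchar chi4 x^-1 = quadChar x * mchar chi4 x.
Proof.
by rewrite -mcharVl // invr_chi4 exprSr mcharMl (mchar_order2 Lphi o2).
Qed.

(** The average over [t] and [1 / t] puts the weight [1 + phi t] on the terms,
    that is, it makes [t] run over the squares [s ^+ 2]; there the summand is
    [phi s] times a function of [s + 1 / s] that is even, so the two terms of
    [sum_quadChar_add_inv] contribute equally. *)
Lemma hyp2F1_chi4 (x : F) : x != 0 -> x != 1 ->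
  #|F|%:R * hyp2F1 chi4 (chi4 ^+ 3) 1 x =
  \sum_w quadChar (w + 2%:R) * quadChar (w ^+ 2 + 4%:R * x - 4%:R).
Proof.
move=> x0 x1; rewrite -invr_chi4 (hyp2F1_inv Lphi o2) //; last first.
  by apply/negP=> c1; have := dvdn_cforder chi4 1; rewrite o4 expr1 c1.
have phiM := quadChar_sqrM Lphi o2.
pose h t := quadChar ((1 - t) ^+ 2 + 4%:R * x * t).
pose k w := quadChar (w ^+ 2 + 4%:R * x - 4%:R).
set S := \sum_t _; set T := \sum_w _.
have SV : S = \sum_t quadChar t * (mchar chi4 t * h t).
  rewrite /S (reindex_inj invr_inj) /=; apply: eq_bigr => t _.
  rewrite mchar4V mulrA; have [->|t0] := eqVneq t 0.
    by rewrite mchar0 mulr0 !mul0r.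
  congr (_ * _); rewrite -(phiM t) //; congr quadChar.
  by field.
suff: S *+ 2 = T *+ 2 by apply: (@pmulrnI _ 2).
rewrite !mulr2n {2}SV addrC.
transitivity (\sum_t (1 + quadChar t) * (mchar chi4 t * h t)).
  by rewrite sum_add1_mul addrC.
rewrite -(sum_sqr Lphi o2 (fun t => mchar chi4 t * h t)).
transitivity (\sum_(s : F | s != 0) quadChar s * k (s + s^-1)).
  rewrite (bigD1 0) //= expr0n mchar0 mul0r add0r; apply: eq_bigr => s s0.
  rewrite mchar_sqr4; congr (_ * _); rewrite -[RHS](phiM s) //; congr quadChar.
  by field.
rewrite (sum_quadChar_add_inv Lphi o2 quadCharN1).
under eq_bigr => w _ do rewrite mulrDl.
rewrite big_split /=; congr (_ + _).
rewrite (reindex_inj oppr_inj); apply: eq_bigr => w _ /=.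
by rewrite -opprD (quadCharN Lphi o2 quadCharN1) /k sqrrN.
Qed.

End QuarticCharacter.

Theorem corollary5p3 (F : finFieldType) (chi4 : multChar F) (a b lambda : F)
    (hq : #|F| = 1 %[mod 4])
    (hchi : chi4 \is a linear_char) (hchi4 : #[chi4]%CF = 4%N)
    (ha : a != 0) (hb : b != 0)
    (hlambda : lambda = a ^+ 2 / b)
    (hlambda0 : lambda != 0) (hlambda1 : lambda != -1) :
  psi24 a b =
    #|F|%:R * quadChar (- b) * hyp2F1 chi4 (chi4 ^+ 3) 1 (- lambda)
    + #|F|%:R * quadChar (- a) * hyp2F1 chi4 (chi4 ^+ 3) 1 (-1 / lambda)
    - 1.
Proof.
have Lphi := lin_char_sqr4 hchi; have o2 := cforder_sqr4 hchi4.
have cubicE (c d : F) : c != 0 -> d != 0 -> c ^+ 2 + d != 0 ->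
    \sum_y quadChar (y + c) * quadChar (y ^+ 2 + d) =
    quadChar (- c) * (#|F|%:R * hyp2F1 chi4 (chi4 ^+ 3) 1 (- (d / c ^+ 2))).
  move=> c0 d0 cd0; rewrite (two_isogeny_sum Lphi o2) // hyp2F1_chi4 //.
    by rewrite oppr_eq0 mulf_neq0 ?invr_eq0 ?expf_neq0.
  apply: contraNneq cd0 => E.
  have -> : c ^+ 2 + d = c ^+ 2 * (1 - - (d / c ^+ 2)) by field.
  by rewrite E subrr mulr0.
have ab0 : a ^+ 2 + b != 0.
  apply: contraNneq hlambda1 => /eqP; rewrite addr_eq0 => /eqP ab.
  by rewrite hlambda ab mulNr divff.
rewrite (psi24_cubic_sums Lphi o2) // !cubicE ?invr_eq0 //; last first.
  have -> : a^-1 ^+ 2 + b^-1 = (a ^+ 2 + b) / (a ^+ 2 * b).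
    by field; rewrite ha hb.
  by rewrite mulf_neq0 ?invr_eq0 // mulf_neq0 ?expf_neq0.
have -> : b / a ^+ 2 = 1 / lambda by rewrite hlambda div1r invf_div.
have -> : b^-1 / a^-1 ^+ 2 = lambda by rewrite exprVn invrK mulrC -hlambda.
have -> : quadChar (- b) = quadChar (a * b) * quadChar (- a^-1).
  by rewrite -(quadCharM Lphi o2); congr quadChar; field.
by rewrite mulNr; ring.
Qed.
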